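(* In Ultimate Tic-Tac-Toe, Olivia (the second player) can resist Xavier's optimal strategy for at least 29 moves: Olivia has a strategy such that, when Xavier follows an optimal winning strategy, Xavier does not win the game before the 29th move (counting the moves of both players).
   Context: **Game.** Ultimate Tic-Tac-Toe is played on a board of 9 fields arranged in a $3\times3$ grid, indexed row by row from the top left: $0,1,2$ / $3,4,5$ / $6,7,8$. Each field consists of 9 spots arranged in a $3\times 3$ grid and indexed in the same way; $(i,j)$ denotes spot $j$ of field $i$. The lines of a $3\times3$ grid are its three rows, three columns and two diagonals. Xavier (marks X) moves first, then Olivia (marks O) and Xavier alternate; a move places one mark in a free spot of the active field. If the previous move was $(i,j)$ and field $j$ has a free spot, the active field is $j$ (whether or not field $j$ has already been won). If the previous move was $(i,j)$ and field $j$ has no free spot, or if there is no previous move, the player to move freely chooses as active field any field with a free spot. A player wins a field when they are the first to have three of their marks on a line of that field; once won, the status of a field never changes, though its free spots can still be played. A player wins the game when they have won three fields forming a line of the board, and the game then ends. If the board is filled with no winner the game is a draw. **Optimality.** A strategy for Xavier is winning if Xavier wins the game in every play consistent with it. The length of a winning strategy is the maximum, over all plays by Olivia, of the total number of moves (by both players) made up to and including Xavier's winning move. A winning strategy for Xavier is optimal if its length is minimal among all winning strategies for Xavier. *)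

(* Defs.v *)
From HB Require Import structures.
From mathcomp Require Import all_boot.

Set Implicit Arguments.
Unset Strict Implicit.
Unset Printing Implicit Defensive.

Variant player := Xavier | Olivia.

Definition is_Xavier (p : player) : bool := if p is Xavier then true else false.
Definition player_of_bool (b : bool) : player := if b then Xavier else Olivia.
Lemma is_XavierK : cancel is_Xavier player_of_bool. Proof. by case. Qed.
HB.instance Definition _ := Equality.copy player (can_type is_XavierK).

(* (i, j) is spot j of field i; both 3 x 3 grids are indexed row by row from
   the top left. *)
Definition spot : Type := ('I_9 * 'I_9)%type.

Definition lines : seq (seq nat) :=
  [:: [:: 0; 1; 2]; [:: 3; 4; 5]; [:: 6; 7; 8];
      [:: 0; 3; 6]; [:: 1; 4; 7]; [:: 2; 5; 8];
      [:: 0; 4; 8]; [:: 2; 4; 6]].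

Definition has_line (grid : 'I_9 -> option player) (p : player) : bool :=
  has (fun L => [forall j : 'I_9, (val j \in L) ==> (grid j == Some p)]) lines.

(* The moves made so far, MOST RECENT FIRST: in m :: h, the move m is played
   after the moves of h. *)
Definition history : Type := seq spot.

Definition to_move (h : history) : player :=
  if odd (size h) then Olivia else Xavier.

Fixpoint mark (h : history) (m : spot) : option player :=
  if h is m' :: h' then
    if m' == m then Some (to_move h') else mark h' m
  else None.

Definition free (h : history) (m : spot) : bool := mark h m == None.

Definition has_free_spot (h : history) (i : 'I_9) : bool :=
  [exists j : 'I_9, free h (i, j)].

(* A field that has been won keeps its winner; otherwise it can only be won
   through the last move, hence by the player who made it. *)
Fixpoint field_winner (h : history) (i : 'I_9) : option player :=
  if h is _ :: h' then
    if field_winner h' i is Some p then Some p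
    else if has_line (fun j => mark h (i, j)) (to_move h')
         then Some (to_move h') else None
  else None.

Definition wins_game (h : history) (p : player) : bool :=
  has_line (field_winner h) p.

Definition board_full (h : history) : bool :=
  [forall i : 'I_9, ~~ has_free_spot h i].

Definition game_over (h : history) : bool :=
  [|| wins_game h Xavier, wins_game h Olivia | board_full h].

Definition may_be_active (h : history) (i : 'I_9) : bool :=
  if h is (_, j) :: _ then has_free_spot h j ==> (i == j) else true.

Definition legal_move (h : history) (m : spot) : bool :=
  [&& ~~ game_over h, may_be_active h m.1 & free h m].

Fixpoint legal_history (h : history) : bool :=
  if h is m :: h' then legal_history h' && legal_move h' m else true.

Definition strategy : Type := history -> spot.

Fixpoint follows (p : player) (s : strategy) (h : history) : bool :=
  if h is m :: h' then
    follows p s h' && ((to_move h' == p) ==> (m == s h'))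
  else true.

Definition consistent (p : player) (s : strategy) (h : history) : bool :=
  legal_history h && follows p s h.

(* A function on histories is a strategy for p when it proposes a legal move in
   every unfinished position, with p to move, that can arise when p uses it;
   its values elsewhere are irrelevant. *)
Definition strategy_for (p : player) (s : strategy) : Prop :=
  forall h, consistent p s h -> to_move h = p -> ~~ game_over h ->
    legal_move h (s h).

(* A complete play is a legal history at which the game is over. *)
Definition winning (s : strategy) : Prop :=
  strategy_for Xavier s /\
  forall h, consistent Xavier s h -> game_over h -> wins_game h Xavier.

(* n is the maximal number of moves of a complete play consistent with s; if s
   is winning, such a play ends with Xavier's winning move. *)
Definition has_length (s : strategy) (n : nat) : Prop :=
  (exists h, [/\ consistent Xavier s h, game_over h & size h = n]) /\
  (forall h, consistent Xavier s h -> game_over h -> size h <= n).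

Definition optimal (s : strategy) : Prop :=
  winning s /\
  exists n, has_length s n /\
    forall s' n', winning s' -> has_length s' n' -> n <= n'.

(* Main.v *)
(** Olivia confines Xavier. With F the field of Xavier's opening move, she fixes
  a diagonal D of the board, avoiding F unless F is the centre. Among her legal
  moves she plays one that sends Xavier off D if she can, else to a corner of D,
  else to the centre, and she sends him to a full field only if forced. As D
  meets every line, a win gives Xavier three marks in some field z of D. Nearly
  all of these follow moves (c, z) of Olivia, made only when the spots of field
  c that point to fields she prefers are taken. So many spots are taken in the
  rows of C, the set of these c.

  That takes many moves. If R is a set of fields containing all full ones, then
  each O mark (r, f) with r in R and f outside R is followed by an X mark in the
  field f, outside R; and each O mark in a field of R answers an X mark whose
  spot is in R. Adding the two lower bounds for the number of X marks so obtained
  gives: the number of marks (r, f) with r in R, where those with f outside R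
  count twice, is at most the number of moves plus one. With R the union of C
  and the full fields this excludes a win within 27 moves. *)

Require Import Defs.
From mathcomp Require Import all_boot.
From mathcomp Require Import zify.

Set Implicit Arguments.
Unset Strict Implicit.
Unset Printing Implicit Defensive.

(** * Histories, full fields and the moves of each player *)

Fixpoint moves (p : player) (h : history) : seq spot :=
  if h is m :: h' then
    if to_move h' == p then m :: moves p h' else moves p h'
  else [::].

(** Boundary term of the counting inductions: a last move that has not been answered yet. *)
Definition last_move_is (p : player) (P : pred spot) (h : history) : bool :=
  if h is m :: h' then (to_move h' == p) && P m else false.

Lemma to_move_cons (m : spot) (h : history) :
  to_move (m :: h) = if to_move h is Xavier then Olivia else Xavier.
Proof. by rewrite /to_move /=; case: (odd (size h)). Qed.

Lemma freeE (h : history) (m : spot) : free h m = (m \notin h).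
Proof.
elim: h => [|m' h IH] //; rewrite inE negb_or -IH /free /= [m == _]eq_sym.
by case: (m' == m).
Qed.

Lemma has_free_spotE (h : history) (i : 'I_9) :
  has_free_spot h i = [exists j : 'I_9, (i, j) \notin h].
Proof. by apply: eq_existsb => j; rewrite freeE. Qed.

Lemma fullP (h : history) (i : 'I_9) :
  reflect (forall j, (i, j) \in h) (~~ has_free_spot h i).
Proof.
rewrite has_free_spotE negb_exists.
by apply: (iffP forallP) => H j; have := H j; rewrite negbK.
Qed.

Lemma has_free_spot_catr (h2 h1 : history) (i : 'I_9) :
  has_free_spot (h2 ++ h1) i -> has_free_spot h1 i.
Proof.
rewrite !has_free_spotE => /existsP[j]; rewrite mem_cat negb_or => /andP[_ Hj].
by apply/existsP; exists j.
Qed.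

Lemma legal_history_catr (h2 h1 : history) :
  legal_history (h2 ++ h1) -> legal_history h1.
Proof. by elim: h2 => //= m h2 IH /andP[/IH]. Qed.

Lemma follows_catr (p : player) (s : strategy) (h2 h1 : history) :
  follows p s (h2 ++ h1) -> follows p s h1.
Proof. by elim: h2 => //= m h2 IH /andP[/IH]. Qed.

Lemma legal_uniq (h : history) : legal_history h -> uniq h.
Proof.
elim: h => //= m h IH /andP[/IH -> /and3P[_ _]].
by rewrite freeE andbT.
Qed.

Lemma legal_next (m o : spot) (h : history) :
  legal_move (o :: h) m -> has_free_spot (o :: h) o.2 -> m.1 = o.2.
Proof. by case: o => i j /and3P[_ /= H _] Hj; move: H; rewrite Hj => /eqP. Qed.

Lemma count_moves (P : pred spot) (h : history) :
  count P (moves Xavier h) + count P (moves Olivia h) = count P h.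
Proof. by elim: h => //= m h IH; case: (to_move h) => /=; lia. Qed.

Lemma size_moves (h : history) :
  size (moves Xavier h) = size (moves Olivia h) + odd (size h).
Proof.
elim: h => //= m h; rewrite /to_move.
by case: (odd (size h)) => /=; lia.
Qed.

Lemma moves_split (p : player) (h : history) (m : spot) :
  m \in moves p h -> exists h2 h1, h = h2 ++ m :: h1 /\ to_move h1 = p.
Proof.
elim: h => //= m' h IH; case: eqP => [Hp|_].
  rewrite inE => /orP[/eqP ->|/IH [h2 [h1 [-> H]]]].
    by exists [::], h.
  by exists (m' :: h2), h1.
by move=> /IH [h2 [h1 [-> H]]]; exists (m' :: h2), h1.
Qed.

Lemma moves_sub (p : player) (h : history) : {subset moves p h <= h}.
Proof.
by move=> m /moves_split[h2 [h1 [-> _]]]; rewrite mem_cat mem_head orbT.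
Qed.

Lemma moves_uniq (p : player) (h : history) : uniq h -> uniq (moves p h).
Proof.
elim: h => //= m h IH /andP[Hm /IH Hu]; case: ifP => //= _.
by rewrite Hu andbT; apply: contra Hm; apply: moves_sub.
Qed.

Lemma mark_moves (p : player) (h : history) (m : spot) :
  mark h m = Some p -> m \in moves p h.
Proof.
elim: h => //= m' h IH; case: eqP => [->|_].
  by case=> ->; rewrite eqxx mem_head.
by move=> /IH H; case: ifP => // _; rewrite inE H orbT.
Qed.

(** * Counting the marks in the rows of a set of fields *)

Definition in_rows (R : {set 'I_9}) : pred spot := fun m => m.1 \in R.
Definition in_cols (R : {set 'I_9}) : pred spot := fun m => m.2 \in R.
Definition leaving (R : {set 'I_9}) : pred spot :=
  fun m => (m.1 \in R) && (m.2 \notin R).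

Section Counting.

Variables (R : {set 'I_9}) (h : history).
Hypotheses (hlegal : legal_history h)
  (hfull : forall i, ~~ has_free_spot h i -> i \in R).


(** A move of Olivia leaving R points to a field outside R, which is not full, so Xavier has to
    reply there. Only her last move can lack a reply. *)
Lemma reply_count :
  count (leaving R) (moves Olivia h) <=
    count (predC (in_rows R)) (moves Xavier h)
    + last_move_is Olivia (leaving R) h.
Proof.
elim: h hlegal hfull => //= m h' IH /andP[Hl Hm] Hf.
have Hf' i : ~~ has_free_spot h' i -> i \in R.
  move=> Hi; apply: Hf; apply: contra Hi; exact: (@has_free_spot_catr [:: m]).
move: {IH}(IH Hl Hf'); case: h' Hl Hm Hf Hf' => [|o h'] Hl Hm Hf Hf'.
  by rewrite /= addn0; lia.
have Hnext : (leaving R) o -> m.1 \notin R.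
  case/andP=> _ Ho; rewrite (legal_next Hm) //.
  by apply: contraR Ho; apply: Hf'.
rewrite to_move_cons /=; case: (to_move h') => /=; last first.
  case: (boolP (leaving R o)) Hnext => [_ ->|_ _] //=; lia.
by lia.
Qed.

(** If Olivia plays in a field of R, Xavier's preceding move pointed either to that field or to a
    full one; both lie in R. *)
Lemma cause_count :
  count (in_rows R) (moves Olivia h)
    + last_move_is Xavier (in_cols R) h
  <= count (in_cols R) (moves Xavier h).
Proof.
elim: h hlegal hfull => //= m h' IH /andP[Hl Hm] Hf.
have Hf' i : ~~ has_free_spot h' i -> i \in R.
  move=> Hi; apply: Hf; apply: contra Hi; exact: (@has_free_spot_catr [:: m]).
move: {IH}(IH Hl Hf'); case: h' Hl Hm Hf Hf' => [|o h'] Hl Hm Hf Hf'.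
  by rewrite /=; lia.
have Hprev : m.1 \in R -> o.2 \in R.
  case: (boolP (has_free_spot (o :: h') o.2)) => [Ho|/Hf' //].
  by rewrite (legal_next Hm Ho).
rewrite to_move_cons /=; case: (to_move h') => /=; last by lia.
rewrite /in_rows /in_cols.
by case: (boolP (m.1 \in R)) Hprev => [_ ->|_ _] //=; lia.
Qed.

(** With Xavier to move, both players have made equally many moves. Adding [reply_count],
    [cause_count] and the fact that Xavier's marks leaving R have a spot outside R yields the
    bound. *)
Lemma occupied_count :
  to_move h = Xavier ->
  count (in_rows R) h + count (leaving R) h <= (size h).+1.
Proof.
move=> Ht.
have Hodd : odd (size h) = false.
  by move: Ht; rewrite /to_move; case: (odd (size h)).
have Hr := leq_trans reply_count (leq_add (leqnn _) (leq_b1 _)).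
have Hc := leq_trans (leq_addr _ _) cause_count.
have Hs := size_moves h; rewrite Hodd in Hs.
have Ha := count_moves predT h; rewrite !count_predT in Ha.
have Hrows := count_moves (in_rows R) h.
have Hleaving := count_moves (leaving R) h.
have Hrows' := count_predC (in_rows R) (moves Xavier h).
have Hcols' := count_predC (in_cols R) (moves Xavier h).
have Hsub : count (leaving R) (moves Xavier h) <=
       count (predC (in_cols R)) (moves Xavier h).
  by apply: sub_count => m /andP[].
lia.
Qed.

End Counting.

Lemma count_setX (A B : {set 'I_9}) (h : history) (P : pred spot) :
  {subset setX A B <= h} -> {subset setX A B <= P} -> uniq h ->
  #|A| * #|B| <= count P h.
Proof.
move=> Hh HP Hu; rewrite -cardsX cardE -size_filter; apply: uniq_leq_size.
  exact: enum_uniq.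
by move=> m; rewrite mem_enum mem_filter => Hm; apply/andP; split;
  [apply: HP | apply: Hh].
Qed.

Definition full_fields (h : history) : {set 'I_9} :=
  [set i | ~~ has_free_spot h i].

(** This is [occupied_count] for the union R of [full_fields h] and C. Rows of full fields are
    complete, rows of C contain B; the parenthesised part counts again the marks leaving R.
    Subtraction is truncated, so a large C does no harm. *)
Lemma occupied_bound (h : history) (C B : {set 'I_9}) :
  legal_history h -> to_move h = Xavier ->
  [disjoint C & full_fields h] ->
  (forall c f, c \in C -> f \in B -> (c, f) \in h) ->
  9 * #|full_fields h| + #|C| * #|B|
  + (#|full_fields h| * (9 - (#|full_fields h| + #|C|))
     + #|C| * (#|B :\: full_fields h| - #|C|)) <= (size h).+1.
Proof.
set Phi := full_fields h => Hl Ht Hdis Hocc.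
have Hu := legal_uniq Hl.
have HPhi r j : r \in Phi -> (r, j) \in h by rewrite inE => /fullP.
pose R := Phi :|: C.
have HR i : ~~ has_free_spot h i -> i \in R by move=> Hi; rewrite !inE Hi.
have := occupied_count Hl HR Ht.
have HC c : c \in C -> c \notin Phi.
  by move=> Hc; rewrite (disjointFr Hdis Hc).
have cardR : #|~: R| = 9 - (#|Phi| + #|C|).
  rewrite cardsCs setCK card_ord cardsU (_ : Phi :&: C = set0) ?cards0 ?subn0 //.
  by apply/eqP; rewrite setI_eq0 disjoint_sym.
have cardB : #|B :\: Phi| - #|C| <= #|B :\: R|.
  have -> : B :\: R = (B :\: Phi) :\: C by rewrite setDDl.
  rewrite [#|B :\: Phi :\: C|]cardsD leq_sub2l // subset_leq_card //.
  exact: subsetIr.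
have split2 (P1 P2 P : pred spot) : (forall m, P1 m -> P m && ~~ P2 m) ->
    (forall m, P2 m -> P m) -> count P1 h + count P2 h <= count P h.
  move=> H1 H2; elim: (h) => //= m s.
  move: (introT implyP (H1 m)) (introT implyP (H2 m)).
  by case: (P1 m) (P2 m) (P m) => [] [] [] //= _ _; lia.
have rows : count (in_rows Phi) h + count (in_rows C) h <= count (in_rows R) h.
  apply: split2 => m; rewrite /in_rows !inE => Hm; rewrite ?Hm ?orbT //=.
  by apply/negP => /HC; rewrite inE Hm.
have leav : count (predI (leaving R) (in_rows Phi)) h
    + count (predI (leaving R) (in_rows C)) h <= count (leaving R) h.
  apply: split2 => m /=; rewrite /in_rows => /andP[-> Hm] //=.
  by apply/negP => /HC; rewrite Hm.
have c1 : #|Phi| * #|[set: 'I_9]| <= count (in_rows Phi) h.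
  apply: count_setX Hu => [[r j]|[r j]]; rewrite inE /= => /andP[Hr _].
    exact: HPhi.
  by rewrite unfold_in.
have c2 : #|C| * #|B| <= count (in_rows C) h.
  apply: count_setX Hu => [[r j]|[r j]]; rewrite inE /= => /andP[Hr Hj].
    exact: Hocc.
  by rewrite unfold_in.
have c3 : #|Phi| * #|~: R| <= count (predI (leaving R) (in_rows Phi)) h.
  apply: count_setX Hu => [[r j]|[r j]]; rewrite inE /= in_setC => /andP[Hr Hj].
    exact: HPhi.
  by rewrite unfold_in /= /leaving /in_rows /= Hj Hr in_setU Hr.
have c4 : #|C| * #|B :\: R| <= count (predI (leaving R) (in_rows C)) h.
  apply: count_setX Hu => [[r j]|[r j]]; rewrite inE /= in_setD => /andP[Hr /andP[Hj HB]].
    exact: Hocc.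
  by rewrite unfold_in /= /leaving /in_rows /= Hj Hr in_setU Hr orbT.
rewrite cardsT card_ord in c1; rewrite cardR in c3.
have c5 := leq_mul (leqnn #|C|) cardB.
lia.
Qed.

(** With C empty, p full fields force 9p + p(9 - p) <= 27, and p = 2 already gives 32. *)
Lemma full_fields_card (h : history) :
  legal_history h -> to_move h = Xavier -> size h <= 26 ->
  #|full_fields h| <= 1.
Proof.
move=> Hl Ht Hs; have := @occupied_bound h set0 set0 Hl Ht.
rewrite -setI_eq0 set0I eqxx cards0 => /(_ isT (fun c f => _)).
have Hle : #|full_fields h| <= 9.
  by rewrite -[X in _ <= X]card_ord; apply: max_card.
move=> /(_ ltac:(by move=> c f; rewrite inE)).
by move: #|_| Hle Hs => [|[|[|[|[|[|[|[|[|[|n]]]]]]]]]]; lia.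
Qed.

(** * Olivia's confining strategy *)

Definition diagonal (F : nat) : seq nat :=
  if F \in [:: 0; 8] then [:: 2; 4; 6] else [:: 0; 4; 8].

(** Lower is better for Olivia: 0 off the diagonal, 1 (a coerced boolean) at its corners, 2 at the
    centre. In [cost] a full destination gets 3, above every rank. *)
Definition rank (F f : nat) : nat := if f == 4 then 2 else f \in diagonal F.

Definition opening_field (h : history) : 'I_9 := (last (ord0, ord0) h).1.

Definition cost (h : history) (m : spot) : nat :=
  if has_free_spot (m :: h) m.2 then rank (opening_field h) m.2 else 3.

(** [pick] supplies the legal move that the argmin needs; the default is reached only where no move
    is legal. *)
Definition confine : strategy := fun h =>
  if [pick m | legal_move h m] is Some m0
  then [arg min_(m < m0 | legal_move h m) cost h m] else (ord0, ord0).

Lemma legal_move_exists (h : history) :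
  ~~ game_over h -> exists m, legal_move h m.
Proof.
move=> Hg.
suff [i Hi [j Hj]] : exists2 i, may_be_active h i & exists j, free h (i, j).
  by exists (i, j); apply/and3P.
move: Hg; rewrite !negb_or => /and3P[_ _ /forallPn[i]].
rewrite negbK => /existsP Hi.
case: h Hi => [|[i' j'] h] Hi; first by exists i.
case: (boolP (has_free_spot ((i', j') :: h) j')) => [Hj|Hj].
  by exists j'; [rewrite /= Hj eqxx | apply/existsP].
by exists i; rewrite //= (negbTE Hj).
Qed.

Lemma confineP (h : history) : ~~ game_over h ->
  legal_move h (confine h) /\
  forall m, legal_move h m -> cost h (confine h) <= cost h m.
Proof.
move=> /legal_move_exists [m Hm]; rewrite /confine.
case: pickP => [m0 Hm0|/(_ m)]; last by rewrite Hm.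
by case: arg_minnP.
Qed.

Lemma rank_le2 (F f : nat) : rank F f <= 2.
Proof. by rewrite /rank; case: ifP => // _; case: (_ \in _). Qed.

Lemma confine_minimal (h2 h1 : history) (m : spot) :
  consistent Olivia confine (h2 ++ m :: h1) -> to_move h1 = Olivia ->
  legal_move h1 m /\ forall m', legal_move h1 m' -> cost h1 m <= cost h1 m'.
Proof.
case/andP=> /legal_history_catr /= /andP[_ Hl] /follows_catr /= /andP[_ Hm] Ht.
move: Hm; rewrite Ht => /eqP Hm.
have /confineP : ~~ game_over h1 by case/andP: Hl.
by rewrite -Hm.
Qed.

Lemma legal_row (h : history) (m : spot) (f : 'I_9) :
  legal_move h m -> (m.1, f) \notin h -> legal_move h (m.1, f).
Proof.
by case/and3P=> Hg Ha _ Hf; apply/and3P; split; rewrite ?freeE.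
Qed.

(** The move (m.1, f) meets the same field constraint as m. If its spot is free, only a full
    destination can make it no better than m. *)
Lemma priority (h2 h1 : history) (m : spot) (f : 'I_9) :
  consistent Olivia confine (h2 ++ m :: h1) -> to_move h1 = Olivia ->
  rank (opening_field h1) f < rank (opening_field h1) m.2 ->
  (m.1, f) \in h1 \/ f != m.1 /\ ~~ has_free_spot h1 f.
Proof.
move=> Hc Ht Hr; have [Hl Hmin] := confine_minimal Hc Ht.
case: (boolP ((m.1, f) \in h1)) => Hf; [by left | right].
have := Hmin _ (legal_row Hl Hf); rewrite /cost /=.
have := rank_le2 (opening_field h1) m.2.
case: (boolP (has_free_spot ((m.1, f) :: h1) f)) => [_|/fullP Hfull] Hr2.
  by case: ifP => _; lia.
move=> _; case: (eqVneq f m.1) => [Hfm|Hfm]; last first.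
  split=> //; apply/fullP => j; have := Hfull j; rewrite inE => /orP[|//].
  by case/eqP=> H _; rewrite H eqxx in Hfm.
(* If f is m.1 itself, (m.1, f) cannot fill that field: spot m.2 is still free for the move actually
   made. *)
have := Hfull m.2; rewrite inE Hfm => /orP[/eqP[H]|].
  by move: Hr; rewrite H Hfm ltnn.
rewrite -surjective_pairing => Hin.
by case/and3P: Hl => _ _; rewrite freeE Hin.
Qed.

(** * Moves of Olivia into full fields, and Xavier's marks in one field *)

Lemma send_to_full (h2 h1 : history) (m : spot) :
  let h := h2 ++ m :: h1 in
  consistent Olivia confine h -> to_move h = Xavier -> size h <= 26 ->
  to_move h1 = Olivia -> ~~ has_free_spot (m :: h1) m.2 ->
  full_fields h = [set m.2] /\ m.1 = m.2.
Proof.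
move=> h Hc HX Hs Ht Hfull; have Hl : legal_history h by case/andP: Hc.
have [Hlm Hmin] := confine_minimal Hc Ht.
have Hk : m.2 \in full_fields h.
  by rewrite inE; apply: contra Hfull; apply: has_free_spot_catr.
have HPhi : full_fields h = [set m.2].
  apply/eqP; rewrite eq_sym eqEcard sub1set Hk cards1 /=.
  exact: full_fields_card.
split=> //; apply/eqP/negPn/negP => Hm.
have Hocc c f : c \in [set m.1] -> f \in [set~ m.2] -> (c, f) \in h.
  rewrite !inE => /eqP -> Hf.
  case: (boolP ((m.1, f) \in h1)) => Hf1.
    by rewrite /h mem_cat inE Hf1 !orbT.
  (* As m costs 3, every free alternative in the same row must lead to a full field too. *)
  have := Hmin _ (legal_row Hlm Hf1); rewrite /cost (negbTE Hfull) /=.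
  case: (boolP (has_free_spot _ f)) => [_|/fullP Hff _].
    by rewrite leqNgt ltnS rank_le2.
  have [Hfm|Hfm] := eqVneq f m.1.
    have := Hff m.2; rewrite Hfm inE => /orP[/eqP[H]|].
      by rewrite H eqxx in Hm.
    rewrite -surjective_pairing => Hin.
    by case/and3P: Hlm => _ _; rewrite freeE Hin.
  suff : f \in full_fields h by rewrite HPhi inE (negbTE Hf).
  rewrite inE; apply/fullP => j; have := Hff j; rewrite inE => /orP[/eqP[H _]|H].
    by rewrite H eqxx in Hfm.
  by rewrite /h mem_cat inE H !orbT.
(* Row m.1 would be occupied in 8 columns, giving 9 + 8 + (7 + 7) = 31 > 27. *)
have := @occupied_bound h [set m.1] [set~ m.2] Hl HX _ Hocc.
rewrite HPhi disjoints1 inE => /(_ Hm).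
have -> : [set~ m.2] :\: [set m.2] = [set~ m.2].
  by apply/setP => i; rewrite !inE andbb.
by rewrite !cards1 cardsC1 card_ord; lia.
Qed.

(* [has_free_spot] is taken after the move, which may itself fill its field. *)
Fixpoint stray (z : 'I_9) (h : history) : nat :=
  if h is m :: h' then
    ((to_move h' == Olivia) && (m.2 != z) && ~~ has_free_spot h m.2) + stray z h'
  else 0.

Lemma strayP (z : 'I_9) (h : history) : 0 < stray z h ->
  exists h2 m h1, [/\ h = h2 ++ m :: h1, to_move h1 = Olivia, m.2 != z
    & ~~ has_free_spot (m :: h1) m.2].
Proof.
elim: h => //= m h IH; case: andP => [[/andP[/eqP H1 H2] H3] _|_].
  by exists [::], m, h.
by rewrite add0n => /IH [h2 [m' [h1 [-> ? ? ?]]]]; exists (m :: h2), m', h1.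
Qed.

Lemma stray_le (z : 'I_9) (h : history) (d : spot) :
  (forall h2 m h1, h = h2 ++ m :: h1 -> to_move h1 = Olivia -> m.2 != z ->
     ~~ has_free_spot (m :: h1) m.2 -> m = d) ->
  stray z h <= count_mem d h.
Proof.
elim: h => //= m h IH H; apply: leq_add; last first.
  by apply: IH => h2 m' h1 E; apply: (H (m :: h2)); rewrite E.
case: andP => // -[/andP[/eqP H1 H2] H3].
by rewrite (H [::] m h) ?eqxx.
Qed.

(** Xavier enters z by the opening move, by replying to a move (c, z), or by free choice after a
    stray move. The boolean on the left is a pending invitation by Olivia's last move. *)
Lemma marks_in_field (z : 'I_9) (h : history) : legal_history h ->
  count (fun m => m.1 == z) (moves Xavier h)
  + (if h is m :: h' then
       (to_move h' == Olivia) && ((m.2 == z) || ~~ has_free_spot h m.2)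
     else false : bool)
  <= count (fun m => m.2 == z) (moves Olivia h)
     + ((h != [::]) && (opening_field h == z)) + stray z h.
Proof.
elim: h => // m [_ _|o h IH /= /andP[/IH{}IH Hm]].
  by rewrite /= !addn0.
have -> : opening_field (m :: o :: h) = opening_field (o :: h) by [].
move: IH; rewrite to_move_cons /=; case: (to_move h) => /=.
  by case: (m.2 == z); case: has_free_spot => /=; lia.
suff : (m.1 == z) <= ((o.2 == z) || ~~ has_free_spot (o :: h) o.2) by lia.
case: (boolP (has_free_spot _ _)) => [/(legal_next Hm) ->|_].
  by rewrite orbF.
by rewrite orbT leq_b1.
Qed.

(** * Estimates limiting Xavier's marks in a field of the diagonal *)

Lemma card_ord9 (P : pred nat) : #|[set i : 'I_9 | P i]| = count P (iota 0 9).
Proof.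
by rewrite -sum1dep_card -val_enum_ord -sum1_count big_map big_enum_cond.
Qed.

(** Checked by computation over all F and z: all 8 other fields are preferred to the centre, the 6
    fields off the diagonal to a corner. *)
Lemma card_rank (F z : 'I_9) : val z \in diagonal F ->
  #|[set f : 'I_9 | rank F f < rank F z]| = (if val z == 4 then 8 else 6)
  /\ (val z == 4) || (F != z).
Proof.
rewrite (card_ord9 (fun f => rank F f < rank F z)) => Hz.
have H : all (fun F => all (fun z =>
    (count (fun f => rank F f < rank F z) (iota 0 9) == if z == 4 then 8 else 6)
    && ((z == 4) || (F != z)))
    (diagonal F)) (iota 0 9) by [].
have HF : val F \in iota 0 9 by rewrite mem_iota /=.
by have /andP[/eqP -> Hne] := allP (allP H _ HF) _ Hz.
Qed.

(** In a history, a larger index means an earlier move; this serves to refute a cyclic order of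
    moves. *)
Lemma index_order (T : eqType) (s2 s1 : seq T) (x y : T) :
  uniq (s2 ++ x :: s1) -> y \in s1 ->
  index x (s2 ++ x :: s1) < index y (s2 ++ x :: s1).
Proof.
rewrite cat_uniq /= negb_or => /and3P[_ /andP[Hx Hs] /andP[Hx1 _]] Hy.
rewrite !index_cat (negbTE Hx) (negbTE (hasPn Hs _ Hy)) /= eqxx.
by case: eqP Hx1 => [->|_ _]; [rewrite Hy | lia].
Qed.

Lemma opening_field_catr (h2 h1 : history) (m : spot) :
  to_move h1 = Olivia -> opening_field (h2 ++ m :: h1) = opening_field h1.
Proof.
by case: h1 => // o h1 _; rewrite /opening_field !last_cat.
Qed.

(** Here c stands for the size of C. The smallest values are 33 for a corner (c = 3) and 32 for the
    centre (c = 2, opening in the centre). *)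
Lemma no_full_field_bound (c : nat) (z4 Fz : bool) :
  c <= 9 -> 3 <= c + Fz -> z4 || ~~ Fz ->
  27 < c * (1 + if z4 then 8 else 6) + c * (1 + (if z4 then 8 else 6) - c).
Proof.
case: z4; case: Fz => //=;
  by move: c => [|[|[|[|[|[|[|[|[|[|c]]]]]]]]]].
Qed.

(** For a full field k, c is the size of [C :\ k], b the number of columns kept, n the number of
    stray moves. The tightest case has k in C and n = 1: then k is neither z nor preferred to z, so
    z is a corner, b = 7, and c = 1 gives 29. *)
Lemma full_field_bound (c b n : nat) (z4 Fz kC kA kz : bool) :
  c <= 9 -> 3 <= kC + c + Fz + n -> z4 || ~~ Fz -> n <= 1 -> kA ==> ~~ kz ->
  z4 ==> kz || kA -> (0 < n) ==> ~~ kz && (kC ==> ~~ kA) ->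
  1 + (if z4 then 8 else 6) = (kz || kA) + b ->
  27 < 9 + c * b + (9 - (1 + c) + c * (b - c)).
Proof.
move=> Hc Hs HF Hn HA Hz Hk Hb.
have -> : b = 1 + (if z4 then 8 else 6) - (kz || kA) by rewrite Hb addKn.
move: {Hb} Hc Hs HF Hn HA Hz Hk.
case: n => [|[|n]]; case: z4; case: Fz; case: kC; case: kA; case: kz;
  by move: c => [|[|[|[|[|[|[|[|[|[|c]]]]]]]]]].
Qed.

(** Meant for the position h before a winning move m. A third mark in z would need so many moves (c,
    z) of Olivia that [occupied_bound] would exceed 27. *)
Lemma few_marks (h : history) (m : spot) (z : 'I_9) :
  legal_history (m :: h) -> consistent Olivia confine h ->
  to_move h = Xavier -> size h <= 26 ->
  val z \in diagonal (opening_field (m :: h)) ->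
  count (fun m => m.1 == z) (moves Xavier (m :: h)) <= 2.
Proof.
move=> Hlm Hc HX Hs Hz; rewrite leqNgt; apply/negP => H3.
have Hl : legal_history h by case/andP: Hc.
have Hu := legal_uniq Hl.
set F := opening_field (m :: h) in Hz.
have HF h2 m' h1 : h = h2 ++ m' :: h1 -> to_move h1 = Olivia ->
    opening_field h1 = F.
  by move=> E Ht; rewrite /F E -cat_cons opening_field_catr.
have [HA HzF] := card_rank Hz.
(* A holds the destinations Olivia prefers to z. By [priority], wherever she played (c, z) the spots
   of c in A that do not point to full fields are taken. *)
set A := [set f : 'I_9 | rank F f < rank F z] in HA.
have zA : z \notin A by rewrite inE ltnn.
pose C := [set c : 'I_9 | (c, z) \in moves Olivia h].
have HC : count (fun m => m.2 == z) (moves Olivia h) <= #|C|.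
  have -> : #|C| = #|setX C [set z]| by rewrite cardsX cards1 muln1.
  rewrite cardE -size_filter.
  apply: uniq_leq_size; first by rewrite filter_uniq // moves_uniq.
  case=> c f; rewrite mem_filter mem_enum !inE /= => /andP[/eqP -> Hcf].
  by rewrite Hcf eqxx.
have Hcount := marks_in_field z Hlm.
have Hstr : stray z (m :: h) = stray z h by rewrite /= HX.
have HO : moves Olivia (m :: h) = moves Olivia h by rewrite /= HX.
rewrite Hstr HO {Hstr HO} in Hcount.
have Hsends : 3 <= #|C| + (F == z) + stray z h.
  have := leq_trans (leq_trans (leq_addr _ _) Hcount) _; move: H3 => /leq_trans H3.
  by move=> /(_ _ (leqnn _)) /H3 /leq_trans; apply; rewrite !leq_add2r.
move: {Hcount H3 HC} Hsends => Hsends.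
have HPhi1 := full_fields_card Hl HX Hs.
have Hocc c f : c \in C -> f \in A :\: full_fields h -> (c, f) \in h.
  rewrite !inE => /moves_split[h2 [h1 [E Ht]]] /andP[Hf Hr].
  have := Hc; rewrite E => /priority /(_ Ht); rewrite (HF _ _ _ E Ht).
  case/(_ f Hr) => [Hin|[_ Hfull]].
    by rewrite mem_cat inE Hin !orbT.
  case/negP: Hf; apply: contra Hfull; rewrite E -cat_rcons.
  exact: has_free_spot_catr.
have Hoccz c : c \in C -> (c, z) \in h by rewrite inE; apply: moves_sub.
have HC9 : #|C| <= 9 by rewrite -[X in _ <= X]card_ord; apply: max_card.
have Hin (C' B : {set 'I_9}) : C' \subset C ->
    B \subset z |: (A :\: full_fields h) ->
    forall c f, c \in C' -> f \in B -> (c, f) \in h.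
  move=> /subsetP HC' /subsetP HB c f /HC' Hcc /HB /setU1P[->|Hf].
    exact: Hoccz.
  exact: Hocc.
(* At most one field is full. If none is, no move strays and the bound is used with C and
   [z |: A]. *)
have [HPhi|[k Hk]] := set_0Vmem (full_fields h).
  have Hstr0 : stray z h = 0.
    apply/eqP; rewrite -leqn0 leqNgt; apply/negP => /strayP[h2 [m' [h1 [E Ht _]]]].
    move=> Hfull; suff : m'.2 \in full_fields h by rewrite HPhi inE.
    by rewrite inE E; apply: contra Hfull; apply: has_free_spot_catr.
  rewrite HPhi setD0 in Hin.
  have := @occupied_bound h C (z |: A) Hl HX _ (Hin _ _ (subxx _) (subxx _)).
  rewrite HPhi -setI_eq0 setI0 eqxx => /(_ isT).
  rewrite setD0 cardsU1 zA HA cards0 mul0n !add0n.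
  rewrite Hstr0 addn0 in Hsends; have := no_full_field_bound HC9 Hsends HzF.
  by rewrite ltnNge => /negP H H'; apply: H; apply: leq_trans H' _.
have HPhi : full_fields h = [set k].
  by apply/eqP; rewrite eq_sym eqEcard sub1set Hk cards1.
have Hstray h2 m' h1 : h = h2 ++ m' :: h1 -> to_move h1 = Olivia ->
    ~~ has_free_spot (m' :: h1) m'.2 -> m' = (k, k).
  move=> E Ht Hfull.
  have [] : full_fields h = [set m'.2] /\ m'.1 = m'.2.
    by move: Hc HX Hs; rewrite E => Hc' HX' Hs'; apply: (send_to_full Hc').
  rewrite HPhi => /set1_inj -> E'.
  by rewrite {1}[m']surjective_pairing E'.
have Hstr1 : stray z h <= 1.
  apply: leq_trans (stray_le (d := (k, k)) _) _; last first.
    by rewrite count_uniq_mem //; case: (_ \in _).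
  by move=> h2 m' h1 E Ht _; apply: Hstray E Ht.
(* A stray move is the move (k, k) completing the full field k; had Olivia
   played (k, z) before it, she would have preferred (k, k). *)
have Hstrk : 0 < stray z h -> k != z /\ (k \in C -> k \notin A).
  move=> /strayP[h2 [m' [h1 [E Ht Hmz Hfull]]]].
  have Em := Hstray _ _ _ E Ht Hfull; rewrite Em /= in E Hmz Hfull.
  split=> //; rewrite inE => /moves_split[h2' [h1' [E' Ht']]].
  apply/negP; rewrite inE => Hr.
  have := Hc; rewrite E' => /priority /(_ Ht'); rewrite (HF _ _ _ E' Ht').
  case/(_ k Hr) => [Hkk|[]]; last by rewrite eqxx.
  have Hkz : (k, z) \in h1.
    have /fullP /(_ z) := Hfull; rewrite inE => /orP[/eqP[Ez]|//].
    by rewrite Ez eqxx in Hmz.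
  have := Hu; rewrite E => /index_order /(_ Hkz); rewrite -E.
  have := Hu; rewrite E' => /index_order /(_ Hkk); rewrite -E' /= => H1 H2.
  by have := ltn_trans H1 H2; rewrite ltnn.
have zkA : k \in A -> k != z by apply: contraTneq => ->.
rewrite HPhi in Hin.
(* Row k already counts as full, so k leaves C; column k is dropped because, for k in A, Olivia may
   pass over (c, k) once k is full. *)
have HB : (z |: A) :\ k \subset z |: A :\ k.
  by apply/subsetP => i; rewrite !inE; case: (i == k); case: (i == z).
have := @occupied_bound h (C :\ k) _ Hl HX _ (Hin _ _ (subsetDl _ _) HB).
rewrite HPhi disjoint_sym disjoints1 setD11 => /(_ isT).
have -> : ((z |: A) :\ k) :\: [set k] = (z |: A) :\ k.
  by apply/setP => i; rewrite !inE andbA andbb.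
have HCk := cardsD1 k C; have HAk := cardsD1 k (z |: A).
rewrite cardsU1 zA HA in_setU1 in HAk.
rewrite HCk in HC9 Hsends.
have Hstrk' : (0 < stray z h) ==> (k != z) && ((k \in C) ==> (k \notin A)).
  by apply/implyP => /Hstrk [-> H]; apply/implyP.
have Hz4 : (val z == 4) ==> (k == z) || (k \in A).
  apply/implyP => /eqP Hz4; rewrite inE /rank Hz4 eqxx -val_eqE /= Hz4.
  by case: eqP => //= _; case: (_ \in _).
have := full_field_bound (leq_trans (leq_addl _ _) HC9) Hsends HzF Hstr1
  (introT implyP zkA) Hz4 Hstrk' HAk.
by rewrite !cards1 mul1n ltnNge => /negP H H'; apply: H; apply: leq_trans H' _.
Qed.

(** * From a won game to three marks in a field of the diagonal *)

Lemma has_line_sub (g g' : 'I_9 -> option player) (p : player) :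
  (forall j, g j = Some p -> g' j = Some p) -> has_line g p -> has_line g' p.
Proof.
move=> H; apply: sub_has => L /forallP HL; apply/forallP => j.
by apply/implyP => /(implyP (HL j)) /eqP /H ->.
Qed.

(** Legal moves use free spots, so the line that won the field is never overwritten. *)
Lemma field_winner_line (h : history) (i : 'I_9) (p : player) :
  legal_history h -> field_winner h i = Some p ->
  has_line (fun j => mark h (i, j)) p.
Proof.
elim: h => //= m h IH /andP[Hl /and3P[_ _ Hm]].
case E: (field_winner h i) => [q|].
  move=> [Hq]; rewrite Hq in E; apply: has_line_sub (IH Hl E) => j Hj.
  by case: eqP => // Emj; move: Hm; rewrite /free Emj Hj.
by case: ifP => // Hline [<-].
Qed.

Lemma three_marks (h : history) (i : 'I_9) : legal_history h ->
  field_winner h i = Some Xavier ->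
  3 <= count (fun m => m.1 == i) (moves Xavier h).
Proof.
move=> Hl /(field_winner_line Hl) /hasP[L HL /forallP HLj].
have /and3P[/eqP HsL HuL HaL] : [&& size L == 3, uniq L & all (gtn 9) L].
  by apply: (allP (_ : all (fun L => [&& size L == 3, uniq L & all (gtn 9) L])
    lines)).
pose s := [seq (i, inord j : 'I_9) | j <- L].
suff : size s <= count (fun m => m.1 == i) (moves Xavier h) by rewrite size_map HsL.
rewrite -size_filter; apply: uniq_leq_size.
  rewrite map_inj_in_uniq // => a b /(allP HaL) /= Ha /(allP HaL) /= Hb [].
  by move/(congr1 val); rewrite /= !inordK.
move=> _ /mapP[j Hj ->]; rewrite mem_filter /= eqxx /=; apply: mark_moves.
have Hj9 : j < 9 := allP HaL _ Hj.
by apply/eqP; apply: (implyP (HLj _)); rewrite /= inordK.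
Qed.

(** Every line of the board meets either diagonal, by inspection of [lines]. *)
Lemma wins_on_diagonal (h : history) (F : nat) : wins_game h Xavier ->
  exists2 z : 'I_9, val z \in diagonal F & field_winner h z = Some Xavier.
Proof.
move=> /hasP[L HL /forallP HLj].
have : has (fun j => (j < 9) && (j \in diagonal F)) L.
  rewrite /diagonal; case: ifP => _; move: L HL {HLj}; exact/allP.
move=> /hasP[j Hj /andP[Hj9 HjF]]; exists (Ordinal Hj9) => //.
by apply/eqP; apply: (implyP (HLj _)).
Qed.

(** A move of Olivia gives Xavier no new field, so the game would have been over before it. *)
Lemma Xavier_wins_on_own_move (h : history) (m : spot) :
  legal_history (m :: h) -> wins_game (m :: h) Xavier -> to_move h = Xavier.
Proof.
move=> /= /andP[_ /andP[Hg _]] Hw; case Ht: (to_move h) => //.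
case/negP: Hg; rewrite /game_over; apply/orP; left.
apply: has_line_sub Hw => i /=; rewrite Ht; case: (field_winner h i) => //.
by case: ifP.
Qed.

Theorem lemma4 :
  exists tau : strategy, strategy_for Olivia tau /\
    forall sigma : strategy, optimal sigma ->
      forall h : history,
        consistent Xavier sigma h -> consistent Olivia tau h ->
        wins_game h Xavier -> 29 <= size h.
Proof.
exists confine; split.
  by move=> h _ _ /confineP[].
move=> _ _ [_ _|m h _ Hc Hw].
  by case/(wins_on_diagonal 0).
have Hl : legal_history (m :: h) by case/andP: Hc.
have HX := Xavier_wins_on_own_move Hl Hw.
have Hc' : consistent Olivia confine h.
  by case/andP: Hc => /= /andP[H1 _] /andP[H2 _]; apply/andP.
have [z Hz Hwz] := wins_on_diagonal (opening_field (m :: h)) Hw.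
have H3 := three_marks Hl Hwz.
rewrite leqNgt; apply/negP => Hs.
(* Xavier's moves have odd numbers, so a win within 28 moves comes within 27 and at most 26 moves
   precede it. *)
have Heven : odd (size h) = false.
  by move: HX; rewrite /to_move; case: (odd (size h)).
have Hs' : size h <= 26.
  by move: Hs; rewrite /= !ltnS leq_eqVlt => /orP[/eqP E|//]; rewrite E in Heven.
by have := few_marks Hl Hc' HX Hs' Hz; rewrite leqNgt H3.
Qed.
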